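(* For every integer $n\ge 1$, \[ \delta(n,7,3)= \begin{cases} \left\lfloor\dfrac{30n}{7}\right\rfloor-1, & n\equiv 4\pmod 7\text{ and }n\ge 11,\\[2mm] \left\lfloor\dfrac{30n}{7}\right\rfloor, & \text{otherwise}. \end{cases} \]
   Context: All graphs are finite and simple. A balanced $7$-partite graph with parts of size $n$ is a graph $G$ whose vertex set is partitioned into $7$ sets $V_1,\dots,V_7$, each of size exactly $n$, with no edge of $G$ having both endpoints in the same $V_i$. For a graph $G$, $\delta(G)$ denotes its minimum degree and $\chi(G)$ its chromatic number. The number $\delta(n,7,3)$ is defined by \[ \delta(n,7,3):=\max\{\delta(G): G\text{ is balanced } 7\text{-partite with parts of size } n\text{ and } \chi(G)\le 3\}. \] *)

(* Defs.v *)
From mathcomp Require Import all_boot.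

Set Implicit Arguments.
Unset Strict Implicit.
Unset Printing Implicit Defensive.

Record sgraph := SGraph {
  vertex :> finType;
  edge : rel vertex;
  edge_sym : symmetric edge;
  edge_irrefl : irreflexive edge
}.

Definition degree (G : sgraph) (x : G) : nat := #|[set y : G | edge x y]|.

(* Every degree is less than #|G|, so the neutral element #|G| is never
   attained unless G has no vertex. *)
Definition min_degree (G : sgraph) : nat :=
  \big[minn/#|G|]_(x : G) degree x.

Definition proper_colouring (G : sgraph) (k : nat) (c : {ffun G -> 'I_k}) : bool :=
  [forall x : G, forall y : G, edge x y ==> (c x != c y)].

Definition colourable (G : sgraph) (k : nat) : bool :=
  [exists c : {ffun G -> 'I_k}, proper_colouring c].

Lemma colourable_exists (G : sgraph) : exists k, colourable G k.
Proof.
exists #|G|; apply/existsP; exists [ffun x => enum_rank x].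
apply/forallP => x; apply/forallP => y; apply/implyP => xy.
rewrite !ffunE; apply: contraTneq xy => /enum_rank_inj ->.
by rewrite edge_irrefl.
Qed.

Definition chromatic_number (G : sgraph) : nat := ex_minn (colourable_exists G).

Definition balanced_partition (G : sgraph) (k n : nat) (V : 'I_k -> {set G}) : Prop :=
  [/\ \bigcup_(i < k) V i = [set: G],
      forall i j, i != j -> [disjoint V i & V j],
      forall i, #|V i| = n
    & forall i x y, x \in V i -> y \in V i -> ~~ edge x y].

Definition balanced_multipartite (G : sgraph) (k n : nat) : Prop :=
  exists V : 'I_k -> {set G}, balanced_partition n V.

Definition is_max (S : nat -> Prop) (m : nat) : Prop :=
  S m /\ forall d, S d -> d <= m.

(* [is_delta n k r d] reads "delta(n, k, r) = d".  It is a relation because the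
   maximum ranges over graphs on arbitrary finite vertex types; [is_max]
   determines d uniquely. *)
Definition is_delta (n k r d : nat) : Prop :=
  is_max (fun d' => exists G : sgraph,
    [/\ balanced_multipartite G k n, chromatic_number G <= r
      & min_degree G = d']) d.

(* Main.v *)
Require Import Defs.
From mathcomp Require Import all_boot.
From mathcomp Require Import zify.

Set Implicit Arguments.
Unset Strict Implicit.
Unset Printing Implicit Defensive.

(** Colour the graph with three colours and record the size a_ij of each cell,
    the set of vertices of part i that have colour j.  A vertex of cell (i, j)
    misses its whole part and its whole colour class, hence has degree at most
    7n - n - C_j + a_ij, where C_j is the sum of column j; and joining all pairs
    of vertices that differ in both part and colour attains this.  So the problem
    is about 7 x 3 matrices of naturals with row sums n: writing D = 6n - d for
    a minimum degree d, minimise D under C_j <= D + a_ij for all nonempty cells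
    ([profile_of_graph], [graph_of_profile]).

    For the upper bound on d, describe a column by its type (s, f): s nonempty
    cells, f of which are full, i.e. equal to n.  Adding the constraints over the
    nonempty cells that are not full gives
    (s - f) C_j + f n <= (s - f) D + C_j ([column_bound]), a bound on C_j in
    terms of the type.  Types cannot be chosen freely: a row has either two
    nonempty cells or a full one, so the sum of s + f over the columns is at
    least 14; and a full cell empties the rest of its row.  Going through the
    finitely many triples of types, if D <= 19n/11 then the column bounds can add
    up to 7n only for the triple (3,0), (3,0), (7,1) ([admissible_cap]).  There
    the bounds read C <= 3D/2 twice and C <= (6D - n)/5, so 7D >= 12n; rounding
    them down also excludes 7D = 12n + 1, the value that ceil(12n/7) would
    require for n = 4 modulo 7.  The threshold 19/11 exceeds 12/7, and
    7D <= 12n + 1 implies D <= 19n/11 as soon as n >= 11, so outside that triple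
    D is large enough.

    For the lower bound, the same triple suggests the matrix: split D as evenly
    as possible into h + l, fill the first column with h, l, l in three rows, the
    second with h, l, l in three others, and put all remaining vertices in the
    third ([extremal_profile]).  For n = 4 one gets h = n, so two of the cells of
    the third column are empty and impose no constraint; this is why n = 4
    escapes the exception. *)

(** * Minimum degree and colourings *)

Lemma leq_bigmin (T : Type) (d m : nat) (s : seq T) (F : T -> nat) :
  (d <= \big[minn/m]_(x <- s) F x) = (d <= m) && all (fun x => d <= F x) s.
Proof.
elim: s => [|x s IHs]; first by rewrite big_nil andbT.
by rewrite big_cons leq_min IHs /= andbCA.
Qed.

Lemma leq_min_degree (G : sgraph) (d : nat) :
  reflect (d <= #|G| /\ forall x : G, d <= degree x) (d <= min_degree G).
Proof.
rewrite leq_bigmin; apply: (iffP andP) => [[dG /allP dx]|[dG dx]]; split=> //.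
  by move=> x; apply: dx; rewrite mem_index_enum.
by apply/allP=> x _; apply: dx.
Qed.

Lemma chromatic_number_leP (G : sgraph) (r : nat) :
  reflect (exists f : G -> 'I_r, forall x y : G, edge x y -> f x != f y)
          (chromatic_number G <= r).
Proof.
rewrite /chromatic_number; case: ex_minnP => m m_col mP.
apply: (iffP idP) => [mr|[f fP]].
  have /existsP[c /forallP cP] := m_col.
  exists (fun x => widen_ord mr (c x)) => x y xy.
  by have /forallP/(_ y)/implyP/(_ xy) := cP x.
apply: mP; apply/existsP; exists (finfun f).
apply/forallP=> x; apply/forallP=> y; apply/implyP=> xy.
by rewrite !ffunE; apply: fP.
Qed.

(** * Graphs and their matrices of cell sizes *)

(** The second clause says that k n - n - C_j + a_ij, the degree of a vertex of
    cell (i, j) when it is joined to everything outside its part and its colour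
    class, is at least d; it is written without subtraction. *)
Definition profile (k r n d : nat) (a : 'I_k -> 'I_r -> nat) : Prop :=
  (forall i, \sum_j a i j = n) /\
  (forall i j, 0 < a i j -> d + n + \sum_i' a i' j <= k * n + a i j).

Lemma sum_card_partition (G : sgraph) (k n : nat) (V : 'I_k -> {set G})
    (K : {set G}) :
  balanced_partition n V -> \sum_i #|V i :&: K| = #|K|.
Proof.
case=> cover_V disj_V _ _.
have cardIK A : #|A :&: K| = \sum_(x in K) (x \in A).
  rewrite -sum1_card big_mkcond [RHS]big_mkcond; apply: eq_bigr => x _.
  by rewrite inE; case: (x \in A); case: (x \in K).
under eq_bigr => i _ do rewrite cardIK.
rewrite exchange_big /= -sum1_card; apply: eq_bigr => x xK.
have : x \in \bigcup_(i < k) V i by rewrite cover_V.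
case/bigcupP=> i _ xVi; rewrite (bigD1 i) //= xVi big1 ?addn0 // => i' ne_i'i.
by rewrite (disjointFl (disj_V _ _ ne_i'i) xVi).
Qed.

Lemma profile_of_graph (G : sgraph) (k r n : nat) :
  balanced_multipartite G k n -> chromatic_number G <= r ->
  exists a : 'I_k -> 'I_r -> nat, profile n (min_degree G) a.
Proof.
case=> V VP /chromatic_number_leP[f fP].
pose K j := [set x | f x == j].
exists (fun i j => #|V i :&: K j|); case: (VP) => _ _ card_V indep_V.
split=> [i|i j].
  rewrite -[RHS](card_V i) -[in RHS]sum1_card (partition_big f xpredT) //=.
  by apply: eq_bigr => j _; rewrite -sum1_card; apply: eq_bigl => x; rewrite !inE.
case/card_gt0P=> x /setIP[xVi xKj].
rewrite (sum_card_partition (K j) VP).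
have card_G : k * n = #|G|.
  rewrite -cardsT -(sum_card_partition setT VP).
  under eq_bigr => i' _ do rewrite setIT card_V.
  by rewrite sum_nat_const card_ord.
have /leq_min_degree[_ /(_ x) min_x] := leqnn (min_degree G).
have nbr_x : [set y : G | edge x y] \subset ~: (V i :|: K j).
  apply/subsetP=> y; rewrite !inE => xy; rewrite negb_or; apply/andP; split.
    by apply: contraTN xy; apply: indep_V.
  by move: xKj (fP _ _ xy); rewrite inE => /eqP->; rewrite eq_sym.
have deg_x := leq_trans min_x (subset_leq_card nbr_x).
have := cardsC (V i :|: K j); have := cardsUI (V i) (K j).
rewrite card_V -card_G; lia.
Qed.

(** A matrix is realised by the edge-maximal graph with these cells: two vertices
    are joined as soon as they differ both in part and in colour. *)
Section BlowUp.

Variables (k r : nat) (a : 'I_k -> 'I_r -> nat).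

Definition blowup_vertex := {p : 'I_k * 'I_r & 'I_(a p.1 p.2)}.

Definition blowup_edge : rel blowup_vertex :=
  fun x y => ((tag x).1 != (tag y).1) && ((tag x).2 != (tag y).2).

Lemma blowup_edge_sym : symmetric blowup_edge.
Proof. by move=> x y; rewrite /blowup_edge ![_ == _ (tag y)]eq_sym. Qed.

Lemma blowup_edge_irrefl : irreflexive blowup_edge.
Proof. by move=> x; rewrite /blowup_edge eqxx. Qed.

Definition blowup := SGraph blowup_edge_sym blowup_edge_irrefl.

Lemma card_blowup_cells (P : pred 'I_k) (Q : pred 'I_r) :
  #|[set x : blowup | P (tag x).1 && Q (tag x).2]|
  = \sum_(i | P i) \sum_(j | Q j) a i j.
Proof.
rewrite pair_big /= -sum1_card big_set /=.
under [RHS]eq_bigr => p _ do rewrite -[a _ _]card_ord -sum1_card.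
by rewrite sig_big_dep /=; apply: eq_bigl => x; rewrite andbT.
Qed.

Lemma graph_of_profile (n d : nat) :
  d <= k * n -> profile n d a ->
  [/\ balanced_multipartite blowup k n, chromatic_number blowup <= r
    & d <= min_degree blowup].
Proof.
move=> d_kn [row_a cell_a].
pose V i := [set x : blowup | (tag x).1 == i].
pose K j := [set x : blowup | (tag x).2 == j].
have card_V i : #|V i| = n.
  have := card_blowup_cells (pred1 i) xpredT; rewrite big_pred1_eq row_a => <-.
  by apply: eq_card => x; rewrite !inE andbT.
have card_K j : #|K j| = \sum_i a i j.
  have := card_blowup_cells xpredT (pred1 j).
  under eq_bigr => i _ do rewrite big_pred1_eq.
  by move=> <-; apply: eq_card => x; rewrite !inE.
have card_VK i j : #|V i :&: K j| = a i j.
  have := card_blowup_cells (pred1 i) (pred1 j); rewrite !big_pred1_eq => <-.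
  by apply: eq_card => x; rewrite !inE.
have card_G : #|blowup| = k * n.
  have := card_blowup_cells xpredT xpredT.
  under eq_bigr => i _ do rewrite row_a.
  rewrite sum_nat_const card_ord => <-.
  by apply: eq_card => x; rewrite !inE.
split.
- exists V; split=> //.
  + by apply/setP=> x; rewrite inE; apply/bigcupP; exists (tag x).1; rewrite ?inE.
  + move=> i j ne_ij; rewrite -setI_eq0; apply/eqP/setP=> x; rewrite !inE.
    by apply: contraNF ne_ij => /andP[/eqP<- /eqP<-].
  + by move=> i x y; rewrite !inE /edge /= /blowup_edge => /eqP-> /eqP->; rewrite eqxx.
- by apply/chromatic_number_leP; exists (fun x : blowup => (tag x).2) => x y /andP[].
apply/leq_min_degree; rewrite card_G; split=> // x.
set i := (tag x).1; set j := (tag x).2.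
have a_gt0 : 0 < a i j by apply: leq_ltn_trans (ltn_ord (tagged x)).
have -> : degree x = #|~: (V i :|: K j)|.
  by apply: eq_card => y; rewrite !inE negb_or ![_ (tag y) == _]eq_sym.
have := cell_a _ _ a_gt0; have := cardsC (V i :|: K j).
have := cardsUI (V i) (K j).
rewrite card_V card_K card_VK card_G; lia.
Qed.

End BlowUp.

(** * Rows and columns of the matrix *)

Section Row.

Variables (I : finType) (n : nat) (b : I -> nat).
Hypotheses (n_gt0 : 0 < n) (sum_b : \sum_j b j = n).

(** A full cell counts twice, once as nonempty and once as full; without one, a
    single nonempty cell could not reach the sum n. *)
Lemma row_support_full : 2 <= \sum_j ((0 < b j) + (b j == n)).
Proof.
have [j b_j] : exists j, 0 < b j.
  apply/existsP; apply: contraTT n_gt0; rewrite negb_exists => /forallP b0.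
  by rewrite -sum_b big1 // => j _; apply/eqP; rewrite -leqn0 leqNgt.
rewrite (bigD1 j) //= b_j; have [//|ne_bj] := eqVneq (b j) n.
have [j' ne_j'j b_j'] : exists2 j', j' != j & 0 < b j'.
  apply/exists_inP; apply: contraNT ne_bj; rewrite negb_exists_in.
  move/forall_inP=> b0; rewrite -sum_b (bigD1 j) //= big1 ?addn0 // => j' ne.
  by apply/eqP; rewrite -leqn0 leqNgt; apply: b0.
by rewrite (bigD1 j') //= b_j'; lia.
Qed.

Lemma row_support_other_full j :
  (0 < b j) + \sum_(j' | j' != j) (b j' == n) <= 1.
Proof.
have : n * \sum_(j' | j' != j) (b j' == n) + b j <= n.
  rewrite -[X in _ <= X]sum_b [X in _ <= X](bigD1 j) //= addnC leq_add2l.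
  rewrite big_distrr /=; apply: leq_sum => j' _.
  by case: eqP => [->|]; rewrite ?muln1 ?muln0.
by case: (b j) => [|m]; nia.
Qed.

End Row.

Definition support (I : finType) (b : I -> nat) : nat := \sum_i (0 < b i).
Definition full (I : finType) (n : nat) (b : I -> nat) : nat := \sum_i (b i == n).

Lemma support_le_card (I : finType) (b : I -> nat) : support b <= #|I|.
Proof. by rewrite -sum1_card; apply: leq_sum => i _; case: (0 < b i). Qed.

Section Column.

Variables (I : finType) (n D : nat) (b : I -> nat).
Let C := \sum_i b i.
Hypotheses (n_gt0 : 0 < n) (b_le : forall i, b i <= n)
  (b_heavy : forall i, 0 < b i -> C <= D + b i).

Let s := support b.
Let f := full n b.

Lemma full_le_support : f <= s.
Proof. by apply: leq_sum => i _; case: eqP => // ->; rewrite n_gt0. Qed.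

Lemma support_partial : s - f = \sum_(i | 0 < b i < n) 1.
Proof.
have -> : s = f + \sum_(i | 0 < b i < n) 1; last by rewrite addKn.
rewrite big_mkcond -big_split /=; apply: eq_bigr => i _.
have := b_le i; rewrite leq_eqVlt; case: eqP => [->|_ /= ->].
  by rewrite n_gt0 ltnn.
by rewrite andbT; case: (0 < b i).
Qed.

Lemma column_sum : C = f * n + \sum_(i | 0 < b i < n) b i.
Proof.
rewrite big_distrl [X in _ + X]big_mkcond -big_split /=; apply: eq_bigr => i _.
have := b_le i; rewrite leq_eqVlt; case: eqP => [->|_ /= ->].
  by rewrite ltnn andbF mul1n addn0.
by rewrite andbT; case: (b i).
Qed.

Lemma column_sum_le_support : C <= s * n.
Proof.
rewrite big_distrl; apply: leq_sum => i _.
by have := b_le i; case: (b i) => //= m; rewrite mul1n.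
Qed.

(** Sum the hypothesis C <= D + b i over the s - f nonempty cells that are not
    full: their values b i add up to C - f n. *)
Lemma column_bound : (s - f) * C + f * n <= (s - f) * D + C.
Proof.
rewrite [X in _ <= _ + X]column_sum addnCA [X in X <= _]addnC leq_add2l.
rewrite support_partial !big_distrl -big_split /=; apply: leq_sum => i.
by case/andP=> /b_heavy; rewrite !mul1n.
Qed.

(** Next to two full cells, a third nonempty cell i would see
    C - b i >= 2 n > D. *)
Lemma full_le1 : 3 <= s -> D < 2 * n -> f <= 1.
Proof.
move=> s_ge3 D_lt.
have [f_lt_s|s_le_f] := ltnP f s.
  have [i /andP[b_gt0 b_lt]] : exists i, 0 < b i < n.
    apply/existsP; apply: contraTT f_lt_s; rewrite negb_exists => /forallP b0.
    rewrite -leqNgt -subn_eq0 support_partial big1 // => i.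
    by rewrite (negbTE (b0 i)).
  have := b_heavy b_gt0; rewrite column_sum (bigD1 i) /= ?b_gt0 //; nia.
have [i b_gt0] : exists i, 0 < b i.
  apply/existsP; apply: contraTT s_ge3; rewrite negb_exists => /forallP b0.
  by rewrite /s /support big1 // => i _; apply/eqP; rewrite eqb0.
have := b_heavy b_gt0; have := b_le i; rewrite column_sum; nia.
Qed.

End Column.

(** * Column types at the threshold 19 n / 11 *)

(** An upper bound, rounded up to an integer multiple of n / 100, for the sum of a
    column of type (s, f) when D <= 19 n / 11: [column_bound] solved for C with
    D = 19 n / 11, or the number of nonempty cells if there are at most two. *)
Definition cap (p : nat * nat) : nat :=
  let: (s, f) := p in
  if s <= 2 then 100 * s
  else (100 * (19 * (s - f) - 11 * f)) %/ (11 * (s - f - 1)) + 1.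

(** The types allowed by [full_le1] in a matrix with seven rows. *)
Definition column_types : seq (nat * nat) :=
  [seq p <- [seq (s, f) | s <- iota 0 8, f <- iota 0 3]
     | (p.2 <= p.1) && ((3 <= p.1) ==> (p.2 <= 1))].

(** The first condition adds [row_support_full] over the seven rows, the others
    add [row_support_other_full]. *)
Definition admissible (p q t : nat * nat) : bool :=
  [&& 14 <= p.1 + q.1 + t.1 + (p.2 + q.2 + t.2),
      p.1 + q.2 + t.2 <= 7, q.1 + p.2 + t.2 <= 7 & t.1 + p.2 + q.2 <= 7].

Definition extremal_types : seq (nat * nat) := [:: (3, 0); (3, 0); (7, 1)].

(** A finite check.  The hypothesis on the caps says that they leave room for all
    7 n vertices.  The closest rejected triple is (3,0), (3,1), (6,1), whose caps
    add up to 697. *)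
Lemma admissible_cap p q t :
  p \in column_types -> q \in column_types -> t \in column_types ->
  admissible p q t -> 700 <= cap p + cap q + cap t ->
  perm_eq [:: p; q; t] extremal_types.
Proof.
have: all (fun p => all (fun q => all (fun t =>
  admissible p q t ==> (700 <= cap p + cap q + cap t) ==>
  perm_eq [:: p; q; t] extremal_types) column_types) column_types) column_types.
  by vm_compute.
move=> /allP all_p /all_p /allP all_q /all_q /allP all_t /all_t.
by move=> /implyP H /H /implyP.
Qed.

(** * The near-extremal matrices *)

(** [column_bound] solved for C, rounded down; meaningful if s - f >= 2. *)
Definition type_bound (n D : nat) (p : nat * nat) : nat :=
  ((p.1 - p.2) * D - p.2 * n) %/ (p.1 - p.2 - 1).

Lemma column_type_bound (I : finType) (n D : nat) (b : I -> nat) :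
  0 < n -> (forall i, b i <= n) -> (forall i, 0 < b i -> \sum_i b i <= D + b i) ->
  full n b + 2 <= support b ->
  \sum_i b i <= type_bound n D (support b, full n b).
Proof.
move=> n_gt0 b_le b_heavy sf; have := column_bound n_gt0 b_le b_heavy.
rewrite /type_bound /= leq_divRL; last by lia.
have -> : support b - full n b = (support b - full n b - 1).+1 by lia.
rewrite subn1 /=; nia.
Qed.

Lemma column_cap (n D : nat) (b : 'I_7 -> nat) :
  0 < n -> 11 * D <= 19 * n ->
  (forall i, b i <= n) -> (forall i, 0 < b i -> \sum_i b i <= D + b i) ->
  (support b, full n b) \in column_types /\
  100 * \sum_i b i <= cap (support b, full n b) * n.
Proof.
move=> n_gt0 D_le b_le b_heavy.
have f_le_s := full_le_support b n_gt0.
have s_le7 : support b <= 7.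
  by have := support_le_card b; rewrite card_ord.
have f_le1 : 3 <= support b -> full n b <= 1.
  by move=> /(full_le1 n_gt0 b_le b_heavy); apply; lia.
split.
  rewrite mem_filter; apply/andP; split; first by rewrite /= f_le_s; apply/implyP.
  apply/allpairsPdep; exists (support b), (full n b); rewrite !mem_iota.
  by split=> //; lia.
rewrite /cap /=; case: (leqP (support b) 2) => [_|s_ge3].
  by rewrite -mulnA leq_mul2l column_sum_le_support.
have := column_bound n_gt0 b_le b_heavy; have := f_le1 s_ge3.
move: (\sum_i b i) (support b) (full n b) f_le_s s_ge3 => C s f _ s_ge3 f1.
set m := s - f - 1; have m_gt0 : 0 < m by lia.
have -> : s - f = m.+1 by lia.
set A := 19 * m.+1 - 11 * f => CD.
have CA : 11 * m * C <= A * n.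
  rewrite /A mulnBl; nia.
have : 100 * A < ((100 * A) %/ (11 * m)).+1 * (11 * m).
  by apply: ltn_ceil; lia.
rewrite addn1; move: (_.+1) => q Aq.
by rewrite -(@leq_pmul2r (11 * m)) //; nia.
Qed.

(** The right-hand side is the sum of the [type_bound]s of the extremal triple
    (3,0), (3,0), (7,1); keeping the roundings is what settles n = 4 modulo 7. *)
Lemma profile_near_extremal (n D : nat) (a : 'I_7 -> 'I_3 -> nat) :
  0 < n -> 11 * D <= 19 * n -> (forall i, \sum_j a i j = n) ->
  (forall i j, 0 < a i j -> \sum_i' a i' j <= D + a i j) ->
  7 * n <= 2 * ((3 * D) %/ 2) + (6 * D - n) %/ 5.
Proof.
move=> n_gt0 D_le row_a heavy_a.
pose col j i := a i j.
pose t j := (support (col j), full n (col j)).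
have a_le j i : col j i <= n.
  by rewrite -(row_a i) (bigD1 j) //= leq_addr.
have [ty cap_le] : (forall j, t j \in column_types) /\
    (forall j, 100 * \sum_i a i j <= cap (t j) * n).
  by split=> j; case: (column_cap n_gt0 D_le (a_le j) (fun i => @heavy_a i j)).
have sum_a : \sum_j \sum_i a i j = 7 * n.
  rewrite exchange_big /=; under eq_bigr => i _ do rewrite row_a.
  by rewrite sum_nat_const card_ord.
have cells : 14 <= \sum_j ((t j).1 + (t j).2).
  rewrite /t /= big_split /= exchange_big [X in _ + X]exchange_big -big_split /=.
  rewrite [leqLHS](_ : _ = \sum_(i < 7) 2); last by rewrite sum_nat_const card_ord.
  by apply: leq_sum => i _; rewrite -big_split; exact: row_support_full n_gt0 (row_a i).
have clash j : (t j).1 + \sum_(j' | j' != j) (t j').2 <= 7.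
  rewrite /t /= exchange_big -big_split /=.
  rewrite [leqRHS](_ : _ = \sum_(i < 7) 1); last by rewrite sum_nat_const card_ord.
  by apply: leq_sum => i _; exact: row_support_other_full n_gt0 (row_a i) j.
pose j1 : 'I_3 := inord 1; pose j2 : 'I_3 := inord 2.
have sum3 (F : 'I_3 -> nat) : \sum_j F j = F ord0 + F j1 + F j2.
  rewrite !big_ord_recl big_ord0 addn0 addnA.
  by congr (F _ + F _ + F _); apply: val_inj; rewrite /= ?inordK.
have perm_t : perm_eq [:: t ord0; t j1; t j2] extremal_types.
  apply: admissible_cap => //.
    move: cells (clash ord0) (clash j1) (clash j2).
    rewrite sum3 ![\sum_(_ | _) _]big_mkcond !sum3 /=.
    rewrite -!val_eqE /= !inordK //= => ? ? ? ?.
    by apply/and4P; split; rewrite /=; lia.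
  rewrite -(@leq_pmul2r n) //.
  by move: sum_a (cap_le ord0) (cap_le j1) (cap_le j2); rewrite sum3; lia.
have bound_t j : \sum_i a i j <= type_bound n D (t j).
  apply: (column_type_bound n_gt0 (a_le j) (fun i => @heavy_a i j)).
  have : t j \in extremal_types.
    rewrite -(perm_mem perm_t).
    have [->|->|->] : [\/ j = ord0, j = j1 | j = j2]; rewrite ?inE ?eqxx ?orbT //.
    case: j => [[|[|[|]]]] // ?; [constructor 1 | constructor 2 | constructor 3];
      by apply: val_inj; rewrite /= ?inordK.
  by rewrite /t !inE !xpair_eqE => /or3P[] /andP[/eqP-> /eqP->].
have <- : \sum_(p <- extremal_types) type_bound n D p
    = 2 * ((3 * D) %/ 2) + (6 * D - n) %/ 5.
  by rewrite !big_cons big_nil /type_bound /= mul0n mul1n subn0; lia.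
rewrite -(perm_big _ perm_t) !big_cons big_nil /= addn0 addnA.
by rewrite -sum_a -(sum3 (type_bound n D \o t)); apply: leq_sum.
Qed.

(** * Upper and lower bounds *)

Definition optimum (n : nat) : nat :=
  if (n == 4 %[mod 7]) && (11 <= n) then (30 * n) %/ 7 - 1 else (30 * n) %/ 7.

Lemma profile_le_optimum (n d : nat) (a : 'I_7 -> 'I_3 -> nat) :
  0 < n -> profile n d a -> d <= optimum n.
Proof.
move=> n_gt0 [row_a cell_a].
have cell_le i j : a i j <= \sum_i' a i' j by rewrite (bigD1 i) //= leq_addr.
have d_le : d <= 6 * n.
  have [j a_gt0] : exists j, 0 < a ord0 j.
    apply/existsP; apply: contraTT n_gt0; rewrite negb_exists => /forallP b0.
    by rewrite -(row_a ord0) big1 // => j _; apply/eqP; rewrite -leqn0 leqNgt.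
  by have := cell_a _ _ a_gt0; have := cell_le ord0 j; lia.
have heavy_a i j : 0 < a i j -> \sum_i' a i' j <= (6 * n - d) + a i j.
  by move=> /cell_a; lia.
(* If 11 D > 19 n then 7 D > 12 n, and even 7 D > 12 n + 1 when n >= 11. *)
rewrite /optimum; have [small|large] := leqP (11 * (6 * n - d)) (19 * n).
  have := profile_near_extremal n_gt0 small row_a heavy_a.
  by case: ifP => [/andP[/eqP]|_]; lia.
by case: ifP => [/andP[/eqP]|_]; lia.
Qed.

Definition extremal_matrix (n D : nat) : seq (seq nat) :=
  let l := D./2 in let h := uphalf D in
  [:: [:: h; 0; n - h]; [:: l; 0; n - l]; [:: l; 0; n - l];
      [:: 0; h; n - h]; [:: 0; l; n - l]; [:: 0; l; n - l];
      [:: 0; 0; n]].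

(** In the first two columns any two cells add up to at most D since h + l = D and
    l <= h.  In the third column the constraints come down to an inequality for
    the cell n - h and one for the cell n - l, each vacuous if the cell is
    empty. *)
Lemma extremal_profile (n : nat) :
  0 < n -> profile n (optimum n)
    (fun (i : 'I_7) (j : 'I_3) =>
       nth 0 (nth [::] (extremal_matrix n (6 * n - optimum n)) i) j).
Proof.
move=> n_gt0; rewrite /extremal_matrix uphalf_half.
set D := 6 * n - optimum n; set l := D./2; set h := odd D + l.
have hD : optimum n + D = 6 * n by rewrite /D /optimum; case: ifP; lia.
have hl : h + l = D by rewrite /h /l; lia.
have lh : l <= h <= l + 1 by rewrite /h; lia.
have [hn hA hB] : [/\ h <= n, h < n -> 2 * n + 4 * (n - l) <= D + h
    & l < n -> 3 * n + 3 * (n - l) <= D + 2 * h].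
  have := erefl D; rewrite {2}/D /optimum; case: ifP => [/andP[/eqP]|]; split; lia.
clearbody D l h; split=> [[[|[|[|[|[|[|[|]]]]]]] //= ?]|].
1-7: by rewrite !big_ord_recl big_ord0 /=; lia.
move=> [i hi] [j hj]; rewrite !big_ord_recl big_ord0 /=.
move: i j hi hj => [|[|[|[|[|[|[|i]]]]]]] [|[|[|j]]] //= _ _; lia.
Qed.

Theorem theorem2p4 (n : nat) (hn : 1 <= n) :
  is_delta n 7 3
    (if (n == 4 %[mod 7]) && (11 <= n) then (30 * n) %/ 7 - 1
     else (30 * n) %/ 7).
Proof.
rewrite -/(optimum n).
have upper (G : sgraph) :
    balanced_multipartite G 7 n -> chromatic_number G <= 3 ->
    min_degree G <= optimum n.
  by move=> /profile_of_graph/[apply] -[a]; apply: profile_le_optimum.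
split; last by move=> _ [G [balG chiG <-]]; apply: upper.
have opt_le : optimum n <= 7 * n by rewrite /optimum; case: ifP; lia.
have [balG chiG minG] := graph_of_profile opt_le (extremal_profile hn).
by eexists; split; [exact: balG | | apply/eqP; rewrite eqn_leq upper].
Qed.
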